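(* Let $S$ be an arbitrary semigroup. Let $P$ be a mapping of $S/\theta$ into $S$ such that $P([a]_{\theta})\in [a]_{\theta}$ for every $[a]_{\theta}\in S/\theta$. Let $P'$ denote the mapping of $S/\theta$ onto $S/\theta^*$ defined by $P'([a]_{\theta})=[a]_{\theta^*}$. Then the right regular representation of the semigroup $(S, S/\theta; \circ_P)$ is isomorphic to the semigroup $(S/\theta^*, S/\theta; \circ_{P'})$.
   Context: For a semigroup $T$, let $\theta_T$ be the relation on $T$ defined by $(a,b)\in\theta_T$ if and only if $xa=xb$ for all $x\in T$. It is a congruence on $T$ (the kernel of the map sending $a\in T$ to the inner right translation $s\mapsto sa$ of $T$), and the factor semigroup $T/\theta_T$ is called the right regular representation of $T$. For the given semigroup $S$ write $\theta=\theta_S$, and let $[s]_\theta$ be the $\theta$-class of $s\in S$. Let $\theta^*$ be the congruence on $S$ with $\theta\subseteq\theta^*$ for which $\theta^*/\theta$ is the kernel of the right regular representation of $S/\theta$, i.e. $(s,t)\in\theta^*$ if and only if $([s]_\theta,[t]_\theta)\in\theta_{S/\theta}$. Equivalently, $(a,b)\in\theta^*$ if and only if $(xa,xb)\in\theta$ for all $x\in S$, i.e. $sa=sb$ for all $s\in S^2$. Let $[s]_{\theta^*}$ be the $\theta^*$-class of $s\in S$. For a semigroup $T$, a non-empty set $\Lambda$ and a mapping $Q:\Lambda\to T$, $(T,\Lambda;\circ_Q)$ denotes the semigroup with underlying set $T\times\Lambda$ and operation $(s,\lambda)\circ_Q(t,\mu)=(s\,Q(\lambda)\,t,\ \mu)$.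 *)

(* Defs.v *)
(* A [semigroupType] carries a choice structure.  Classically every type has
   one ([gen_choiceMixin] and [{classic T}] in boolp), so arbitrary semigroups
   are covered; boolp's [asbool] likewise makes the relations
   below boolean without any decidability assumption. *)
From HB Require Import structures.
From mathcomp Require Import all_boot.
From mathcomp Require Import boolp.

Set Implicit Arguments.
Unset Strict Implicit.
Unset Printing Implicit Defensive.

Local Open Scope group_scope.
Local Open Scope quotient_scope.

Record congruence (T : semigroupType) := Congruence {
  cong_rel :> equiv_rel T;
  congM : forall a b c d : T,
    cong_rel a b -> cong_rel c d -> cong_rel (a * c) (b * d)
}.

Definition factor (T : semigroupType) (r : congruence T) := {eq_quot r}.

Section Factor.
Variables (T : semigroupType) (r : congruence T).

HB.instance Definition _ := Choice.on (factor r).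
HB.instance Definition _ := EqQuotient.on (factor r).

Lemma factor_eqP (a b : T) : reflect (a = b %[mod factor r]) (r a b).
Proof. exact: eqquotP. Qed.

(* Computed on chosen representatives; [factor_piM] shows that the choice is
   irrelevant, i.e. that [a][b] = [ab]. *)
Definition factor_mul : factor r -> factor r -> factor r :=
  lift_op2 (factor r) (@mul T).

Lemma factor_mul_pi (a b : T) :
  factor_mul (\pi_(factor r) a) (\pi_(factor r) b) = \pi_(factor r) (a * b).
Proof. by unlock factor_mul; apply/factor_eqP/congM; apply/factor_eqP; rewrite reprK. Qed.

Lemma factor_mulA : associative factor_mul.
Proof.
move=> u v w; rewrite -[u]reprK -[v]reprK -[w]reprK.
by rewrite !factor_mul_pi mulgA.
Qed.

HB.instance Definition _ := isSemigroup.Build (factor r) factor_mulA.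

Lemma factor_piM (a b : T) :
  \pi_(factor r) (a * b) = \pi_(factor r) a * \pi_(factor r) b.
Proof. by rewrite -factor_mul_pi. Qed.

End Factor.

Section Theta.
Variable T : semigroupType.

Definition theta_rel : rel T := fun a b => `[< forall x : T, x * a = x * b >].

Lemma theta_rel_refl : reflexive theta_rel.
Proof. by move=> a; apply/asboolP. Qed.

Lemma theta_rel_sym : symmetric theta_rel.
Proof. by move=> a b; apply/asboolP/asboolP => ab x; rewrite ab. Qed.

Lemma theta_rel_trans : transitive theta_rel.
Proof.
by move=> b a c /asboolP ab /asboolP bc; apply/asboolP => x; rewrite ab.
Qed.

Definition theta_equiv : equiv_rel T :=
  EquivRel theta_rel theta_rel_refl theta_rel_sym theta_rel_trans.

Lemma theta_relM (a b c d : T) :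
  theta_equiv a b -> theta_equiv c d -> theta_equiv (a * c) (b * d).
Proof.
by move=> /asboolP ab /asboolP cd; apply/asboolP => x; rewrite !mulgA ab cd.
Qed.

Definition theta : congruence T := Congruence theta_relM.

Lemma thetaP (a b : T) : reflect (forall x : T, x * a = x * b) (theta a b).
Proof. exact: asboolP. Qed.

End Theta.

Definition right_regular (T : semigroupType) := factor (theta T).

HB.instance Definition _ (T : semigroupType) := Semigroup.on (right_regular T).

Section ThetaStar.
Variable S : semigroupType.

Definition thetastar_rel : rel S := fun s t =>
  theta (factor (theta S)) (\pi_(factor (theta S)) s) (\pi_(factor (theta S)) t).

Lemma thetastar_rel_refl : reflexive thetastar_rel.
Proof. by move=> a; apply: equiv_refl. Qed.

Lemma thetastar_rel_sym : symmetric thetastar_rel.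
Proof. by move=> a b; apply: equiv_sym. Qed.

Lemma thetastar_rel_trans : transitive thetastar_rel.
Proof. by move=> b a c; apply: equiv_trans. Qed.

Definition thetastar_equiv : equiv_rel S :=
  EquivRel thetastar_rel
    thetastar_rel_refl thetastar_rel_sym thetastar_rel_trans.

Lemma thetastar_relM (a b c d : S) :
  thetastar_equiv a b -> thetastar_equiv c d ->
  thetastar_equiv (a * c) (b * d).
Proof.
by move=> ab cd; rewrite /= /thetastar_rel !factor_piM; apply: congM.
Qed.

Definition thetastar : congruence S := Congruence thetastar_relM.

Lemma thetastarP (a b : S) :
  reflect (forall x y : S, x * y * a = x * y * b) (thetastar a b).
Proof.
apply: (iffP (thetaP _ _)) => [ab x y | ab u].
  have := ab (\pi_(factor (theta S)) y).
  by rewrite -!factor_piM => /factor_eqP/thetaP; rewrite -!mulgA.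
rewrite -[u]reprK -!factor_piM.
by apply/factor_eqP/thetaP => x; rewrite !mulgA.
Qed.

Lemma theta_sub_thetastar (a b : S) : theta S a b -> thetastar a b.
Proof. by move=> /thetaP ab; apply/thetastarP => x y; rewrite ab. Qed.

(* [a]_theta |-> [a]_thetastar, computed on a chosen representative;
   [theta_to_thetastar_pi] shows that the choice is irrelevant. *)
Definition theta_to_thetastar (u : factor (theta S)) : factor thetastar :=
  \pi_(factor thetastar) (repr u).

Lemma theta_to_thetastar_pi (a : S) :
  theta_to_thetastar (\pi_(factor (theta S)) a) = \pi_(factor thetastar) a.
Proof.
by apply/factor_eqP/theta_sub_thetastar; apply/factor_eqP; rewrite reprK.
Qed.

Lemma theta_to_thetastar_surj (v : factor thetastar) :
  exists u, theta_to_thetastar u = v.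
Proof.
exists (\pi_(factor (theta S)) (repr v)).
by rewrite theta_to_thetastar_pi reprK.
Qed.

End ThetaStar.

(* The semigroup (T, L; o_Q).  [Q] does not occur in the carrier: it is kept as a parameter
   of the type so that it selects the multiplication. *)
Definition sandwich (T : semigroupType) (L : choiceType) (Q : L -> T) : Type :=
  (T * L)%type.

Section Sandwich.
Variables (T : semigroupType) (L : choiceType) (Q : L -> T).

HB.instance Definition _ := Choice.copy (sandwich Q) (T * L)%type.

Definition sandwich_mul (u v : sandwich Q) : sandwich Q :=
  (u.1 * Q u.2 * v.1, v.2).

Lemma sandwich_mulA : associative sandwich_mul.
Proof. by move=> u v w; rewrite /sandwich_mul /= !mulgA. Qed.

HB.instance Definition _ := isSemigroup.Build (sandwich Q) sandwich_mulA.

End Sandwich.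

Definition isomorphic (A B : semigroupType) : Prop :=
  exists f : {multiplicative A -> B}, bijective f.

(* Main.v *)
Require Import Defs.
From HB Require Import structures.
From mathcomp Require Import all_boot.
From mathcomp Require Import boolp.

(** Write [s]* for the class of [s] modulo [thetastar].  The map
    (s, l) |-> ([s]*, l) is a surjective morphism from (S, S/theta; o_P) onto
    (S/theta*, S/theta; o_P'), so by the homomorphism theorem only its kernel
    has to be identified with the theta-relation of (S, S/theta; o_P).  There,
    (s, l) and (t, m) are related iff l = m and x P(n) s = x P(n) t for all
    [x] in [S] and [n] in S/theta.  That condition holds when [s] and [t] are
    thetastar-related, because x P(n) is a product of two elements.
    Conversely, P sends the theta-class of y to an element
    theta-related to y, so x y = x P(n) for n that class: the
    elements x P(n) exhaust S^2, and the condition is the one in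
    [thetastarP]. *)

Set Implicit Arguments.
Unset Strict Implicit.
Unset Printing Implicit Defensive.

Local Open Scope group_scope.
Local Open Scope quotient_scope.

(** The homomorphism theorem.  Surjectivity is given by a section [g], from
    which the inverse isomorphism is read off directly. *)
Lemma factor_isomorphic (T U : semigroupType) (r : congruence T)
    (f : T -> U) (g : U -> T) :
  {morph f : a b / a * b} -> cancel g f ->
  (forall a b, r a b <-> f a = f b) -> isomorphic (factor r) U.
Proof.
move=> fM gK kerf.
pose h (u : factor r) := f (repr u).
have h_pi a : h (\pi_(factor r) a) = f a.
  by apply/kerf/factor_eqP; rewrite reprK.
have hM : {morph h : u v / u * v}.
  by move=> u v; rewrite -[u in LHS]reprK -[v in LHS]reprK -factor_piM h_pi fM.
exists (HB.pack_for {multiplicative factor r -> U} h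
  (isMultiplicative.Build _ _ h hM)).
exists (fun u => \pi_(factor r) (g u)) => [u | u]; last by rewrite /= h_pi gK.
by rewrite -[RHS]reprK; apply/factor_eqP/kerf; rewrite gK.
Qed.

Section SandwichRepresentatives.
Variables (S : semigroupType) (P : factor (theta S) -> S).
Hypothesis hP : forall a : S, theta S a (P (\pi_(factor (theta S)) a)).

Lemma mul_representative (x a : S) :
  x * P (\pi_(factor (theta S)) a) = x * a.
Proof. by have /thetaP -> := hP a. Qed.

(** Any choice of representatives computes the canonical map onto S/theta*,
    because theta is contained in [thetastar].  This makes [sandwich_class]
    multiplicative: the middle factor P(l) is sent to P'(l). *)
Lemma theta_to_thetastarE (u : factor (theta S)) :
  theta_to_thetastar u = \pi_(factor (thetastar S)) (P u).
Proof.
rewrite -[u]reprK theta_to_thetastar_pi.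
exact/factor_eqP/theta_sub_thetastar.
Qed.

(** Left factors of a product only contribute through x P(n); as [P] meets
    every theta-class, these elements range over all of S^2, which is what
    [thetastar] tests against. *)
Lemma theta_sandwichP (u v : sandwich P) :
  theta (sandwich P) u v <-> thetastar S u.1 v.1 /\ u.2 = v.2.
Proof.
split=> [/thetaP uv | [/thetastarP uv1 uv2]].
  (* Any left factor reveals the second component; [u] itself is at hand. *)
  split; last by have [] := uv u.
  apply/thetastarP => x y.
  have [] := uv (x, \pi_(factor (theta S)) y).
  by rewrite /= !mul_representative.
apply/thetaP => -[x n]; congr (_, _); [exact: uv1 | exact: uv2].
Qed.

Definition sandwich_class (u : sandwich P) : sandwich (@theta_to_thetastar S) :=
  (\pi_(factor (thetastar S)) u.1, u.2).

Lemma sandwich_classM : {morph sandwich_class : u v / u * v}.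
Proof.
move=> u v; congr (_, _).
by rewrite /= theta_to_thetastarE !factor_piM.
Qed.

Lemma sandwich_class_kernel (u v : sandwich P) :
  theta (sandwich P) u v <-> sandwich_class u = sandwich_class v.
Proof.
rewrite theta_sandwichP /sandwich_class.
by split=> [[/factor_eqP -> ->] | [/factor_eqP]].
Qed.

End SandwichRepresentatives.

Theorem theorem1 (S : semigroupType) (P : factor (theta S) -> S)
    (hP : forall a : S, theta S a (P (\pi_(factor (theta S)) a))) :
  isomorphic (right_regular (sandwich P))
             (sandwich (@theta_to_thetastar S)).
Proof.
pose lift_class (w : sandwich (@theta_to_thetastar S)) : sandwich P :=
  (repr w.1, w.2).
have lift_classK : cancel lift_class (@sandwich_class S P).
  by case=> w l; rewrite /sandwich_class /= reprK.
exact: factor_isomorphic (sandwich_classM hP) lift_classK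
  (sandwich_class_kernel hP).
Qed.
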